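(* Miller forcing $\mathbb M$ forces that every two unbounded sequences $b,c$ belonging to the ground model are locked.
   Context: An unbounded sequence is an $\omega_1$-sequence of increasing functions in $\omega^\omega$, increasing in the modulo-finite (eventual domination) ordering, with no upper bound in the eventual domination ordering. Unbounded sequences $b,c$ are locked if there is an infinite set $x\subseteq\omega$ such that for every $\alpha\in\omega_1$ there is $\beta\in\omega_1$ with $b(\beta)\restriction x$ eventually dominating $c(\alpha)\restriction x$, and for every $\alpha\in\omega_1$ there is $\beta\in\omega_1$ with $c(\beta)\restriction x$ eventually dominating $b(\alpha)\restriction x$. Miller forcing $\mathbb M$ is the set of nonempty trees $T\subseteq\omega^{<\omega}$ consisting of increasing sequences such that every $t\in T$ has an extension in $T$ which is a splitnode of $T$, and every splitnode of $T$ has infinitely many immediate successors in $T$; it is ordered by inclusion. *)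

(* Defs.v *)
From mathcomp Require Import all_boot.
From mathcomp Require Import boolp classical_sets cardinality.
Set Implicit Arguments.
Unset Strict Implicit.
Unset Printing Implicit Defensive.

Local Open Scope classical_set_scope.

(* The ground model is the ambient universe: omega is [nat], omega^omega is
   [nat -> nat], and omega_1 is any well-ordered type of order type omega_1,
   i.e. an uncountable well-order all of whose proper initial segments are
   countable (this determines it up to isomorphism). *)
Record is_omega1 (W : Type) (lt : W -> W -> Prop) : Prop := IsOmega1 {
  omega1_trans : forall a b c, lt a b -> lt b c -> lt a c;
  omega1_total : forall a b, lt a b \/ a = b \/ lt b a;
  omega1_wf : well_founded lt;
  omega1_uncountable : ~ countable [set: W];
  omega1_segments : forall a, countable [set b | lt b a]
}.

(* the dominating function comes first *)
Definition dominates (f g : nat -> nat) : Prop :=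
  exists n, forall m, n <= m -> g m <= f m.

(* Both monotonicity requirements are weak, so that sequences satisfying the
   strict variants are included. *)
Record unbounded_sequence (W : Type) (lt : W -> W -> Prop)
    (b : W -> nat -> nat) : Prop := UnboundedSequence {
  unbounded_increasing : forall a m n, m <= n -> b a m <= b a n;
  unbounded_modfin : forall a a', lt a a' -> dominates (b a') (b a);
  unbounded_nobound : ~ exists g, forall a, dominates g (b a)
}.

Record forcing_notion := ForcingNotion {
  condition :> Type;
  stronger : condition -> condition -> Prop;
  stronger_refl : forall p, stronger p p;
  stronger_trans : forall p q r, stronger p q -> stronger q r -> stronger p r
}.

Definition dense_below (P : forcing_notion) (p : P) (D : set P) : Prop :=
  forall q, stronger q p -> exists2 r, stronger r q & D r.

(* A name for a subset of omega: a set of pairs (check n, p).  Every subset of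
   omega in the generic extension has a name of this form. *)
Definition real_name (P : forcing_notion) := nat -> set P.

(* Formulas of the forcing language.  [Ground Q] is a statement about the
   ground model.  Quantifiers range over a type A: if A is a ground-model set
   this is bounded quantification over its check name; if A is [real_name P]
   this is quantification over all subsets of omega in the extension. *)
Inductive formula (P : forcing_notion) : Type :=
| Ground of Prop
| Member of nat & real_name P
| Not of formula P
| And of formula P & formula P
| Imp of formula P & formula P
| All (A : Type) of (A -> formula P)
| Ex (A : Type) of (A -> formula P).

Arguments Ground {P} _.
Arguments Member {P} _ _.
Arguments Not {P} _.
Arguments And {P} _ _.
Arguments Imp {P} _ _.
Arguments All {P A} _.
Arguments Ex {P A} _.

(* In the clause for [Imp], a formula forced densely below q is forced by q, so
   this agrees with "no q <= p forces both phi1 and not phi2". *)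
Fixpoint forces (P : forcing_notion) (p : P) (phi : formula P) : Prop :=
  match phi with
  | Ground Q => Q
  | Member n x => dense_below p [set q | exists2 r, x n r & stronger q r]
  | Not phi1 => forall q, stronger q p -> ~ forces q phi1
  | And phi1 phi2 => forces p phi1 /\ forces p phi2
  | Imp phi1 phi2 => forall q, stronger q p -> forces q phi1 -> forces q phi2
  | All A phi1 => forall a : A, forces p (phi1 a)
  | Ex A phi1 => dense_below p [set q | exists a : A, forces q (phi1 a)]
  end.

Definition notion_forces (P : forcing_notion) (phi : formula P) : Prop :=
  forall p : P, forces p phi.

Definition infinite_formula (P : forcing_notion) (x : real_name P) :
    formula P :=
  All (fun k : nat => Ex (fun m : nat => And (Ground (k <= m)) (Member m x))).

(* the restriction of f to x eventually dominates the restriction of g to x *)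
Definition dominates_on_formula (P : forcing_notion) (x : real_name P)
    (f g : nat -> nat) : formula P :=
  Ex (fun n : nat => All (fun m : nat =>
    Imp (And (Ground (n <= m)) (Member m x)) (Ground (g m <= f m)))).

Definition locked_formula (P : forcing_notion) (W : Type)
    (b c : W -> nat -> nat) : formula P :=
  Ex (fun x : real_name P =>
    And (infinite_formula x)
   (And (All (fun a : W => Ex (fun a' : W =>
           dominates_on_formula x (b a') (c a))))
        (All (fun a : W => Ex (fun a' : W =>
           dominates_on_formula x (c a') (b a)))))).

Definition successors (T : set (seq nat)) (t : seq nat) : set nat :=
  [set n | T (rcons t n)].

Definition splitnode (T : set (seq nat)) (t : seq nat) : Prop :=
  T t /\ exists m n, [/\ m <> n, successors T t m & successors T t n].

Record is_miller_tree (T : set (seq nat)) : Prop := IsMillerTree {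
  miller_nonempty : exists t, T t;
  miller_tree : forall s t, prefix s t -> T t -> T s;
  miller_increasing : forall t, T t -> sorted ltn t;
  miller_split : forall t, T t -> exists2 s, prefix t s & splitnode T s;
  miller_infinite : forall t, splitnode T t -> infinite_set (successors T t)
}.

Definition miller_condition := {T : set (seq nat) | is_miller_tree T}.

Definition miller_stronger (S T : miller_condition) : Prop :=
  sval S `<=` sval T.

Lemma miller_stronger_refl (T : miller_condition) : miller_stronger T T.
Proof. by []. Qed.

Lemma miller_stronger_trans (S T U : miller_condition) :
  miller_stronger S T -> miller_stronger T U -> miller_stronger S U.
Proof. by move=> ST TU t /ST /TU. Qed.

Definition miller_forcing : forcing_notion :=
  ForcingNotion miller_stronger_refl miller_stronger_trans.

(* Main.v *)
Require Import Defs.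
From mathcomp Require Import all_boot.
From mathcomp Require Import boolp classical_sets cardinality.

Set Implicit Arguments.
Unset Strict Implicit.
Unset Printing Implicit Defensive.

Local Open Scope classical_set_scope.

(** The range x of the generic branch locks all pairs of ground-model sequences.
    Given a condition T and a function g = c(alpha), each successor n of a
    splitnode r of T determines the stem above r^n, and so a bound M on the
    entries met up to the next splitnode.  As the functions b(beta) are
    increasing, b stays unbounded on the infinite set of successors of r, so
    some beta satisfies g(M) <= b(beta)(n) for infinitely many n, and since
    omega_1 has uncountable cofinality one beta serves all splitnodes.  Keeping
    only these successors n gives a stronger condition, in which monotonicity of
    both functions yields g(m) <= b(beta)(m) for every entry m beyond the
    stem. *)

Lemma infinite_natP (A : set nat) :
  infinite_set A <-> forall k, exists2 n, k <= n & A n.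
Proof.
split=> [Ainf k | Aunb /finite_seqP[s As]].
  have [n [An /negP]] := infinite_setN0 (infinite_setD Ainf (finite_II k)).
  by rewrite -leqNgt; exists n.
have [n] := Aunb (\max_(m <- s) m).+1; rewrite As /= => + ns.
by rewrite ltnNge leq_bigmax_seq.
Qed.

Section Prefixes.
Variable T : eqType.
Implicit Types (s t u : seq T) (x y : T).

Lemma prefixs_rcons s t x :
  prefix s (rcons t x) = (s == rcons t x) || prefix s t.
Proof.
apply/idP/predU1P => [|[->|st]]; first last.
- exact: prefix_trans st (prefix_rcons t x).
- exact: prefix_refl.
case/prefixP => u; case/lastP: u => [|u y].
  by rewrite cats0 => ->; left.
by rewrite -rcons_cat => /rcons_inj[-> _]; right; apply: prefix_prefix.
Qed.

Lemma prefix_rcons_inj s t x y :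
  prefix (rcons s x) t -> prefix (rcons s y) t -> x = y.
Proof.
by rewrite !prefixE !size_rcons => /eqP-> /eqP/rcons_inj[].
Qed.

Lemma prefix_neq_rcons s t :
  prefix s t -> s != t -> exists x, prefix (rcons s x) t.
Proof.
case/prefixP => -[|x u] ->; first by rewrite cats0 eqxx.
by move=> _; exists x; rewrite -cat_rcons prefix_prefix.
Qed.

Lemma prefix_total s t u : prefix s u -> prefix t u -> prefix s t || prefix t s.
Proof.
move=> su tu; wlog st : s t su tu / size s <= size t => [total|].
  have [|/ltnW ts] := leqP (size s) (size t); first exact: total.
  by rewrite orbC total.
apply/orP; left; move: su tu; rewrite !prefixE => su /eqP tE.
by rewrite -tE take_takel.
Qed.

Lemma mem_rcons_prefixP x s :
  reflect (exists t, prefix (rcons t x) s) (x \in s).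
Proof.
apply: (iffP idP) => [/splitPr[s1 s2]|[t /prefixP[u ->]]].
  by exists s1; rewrite -cat_rcons prefix_prefix.
by rewrite mem_cat mem_rcons mem_head.
Qed.

End Prefixes.

Lemma sorted_ltn_leq_last (s : seq nat) m n :
  sorted ltn (rcons s n) -> m \in rcons s n -> m <= n.
Proof.
rewrite (sorted_pairwise ltn_trans) pairwise_rcons => /andP[/allP s_lt_n _].
by rewrite mem_rcons inE => /predU1P[->//|/s_lt_n/ltnW].
Qed.

Section UnboundedSequences.
Variables (W : Type) (lt : W -> W -> Prop).

Lemma omega1_countable_bounded (I : countType) (f : I -> W) :
  is_omega1 lt -> exists w, forall i, lt (f i) w \/ f i = w.
Proof.
move=> hW; apply: contrapT => nobound; apply: (omega1_uncountable hW).
have -> : [set: W] = \bigcup_i [set w | lt w (f i)].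
  apply/seteqP; split => // w _; apply: contrapT => noi; apply: nobound.
  exists w => i; have [|[|]] := omega1_total hW (f i) w; [by left|by right|].
  by move=> wf; case: noi; exists i.
apply: bigcup_countable => [|i _]; first exact: countableP.
exact: omega1_segments hW _.
Qed.

Lemma dominates_infinite_setI (Y : set nat) (f g h : nat -> nat) :
  dominates f g -> infinite_set (Y `&` [set n | h n <= g n]) ->
  infinite_set (Y `&` [set n | h n <= f n]).
Proof.
move=> [N fg] /infinite_natP Yhg; apply/infinite_natP => k.
have [n] := Yhg (maxn N k); rewrite geq_max => /andP[Nn kn] [Yn hgn].
by exists n => //; split=> //; apply: leq_trans hgn (fg n Nn).
Qed.

Lemma unbounded_on_infinite_set (b : W -> nat -> nat) (Y : set nat)
    (h : nat -> nat) :
  (forall w, {homo b w : m n / m <= n}) ->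
  ~ (exists g, forall w, dominates g (b w)) -> infinite_set Y ->
  exists w, infinite_set (Y `&` [set n | h n <= b w n]).
Proof.
move=> b_incr nobound /infinite_natP Yinf; apply: contrapT => nohit.
have /choice[next nextP] : forall k, exists n, k <= n /\ Y n.
  by move=> k; have [n] := Yinf k; exists n.
apply: nobound; exists (h \o next) => w.
apply: contrapT => ndom; apply: nohit; exists w.
apply/infinite_natP => k; apply: contrapT => nohit_above; apply: ndom.
exists k => m km; have [m_next Ynext] := nextP m.
apply: leq_trans (b_incr w _ _ m_next) _; rewrite leqNgt.
apply/negP => /ltnW hb; apply: nohit_above.
by exists (next m); first exact: leq_trans m_next.
Qed.

Lemma unbounded_on_countably_many (b : W -> nat -> nat) (I : countType)
    (Y : I -> set nat) (h : I -> nat -> nat) :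
  is_omega1 lt -> unbounded_sequence lt b ->
  exists w, forall i, infinite_set (Y i) ->
    infinite_set (Y i `&` [set n | h i n <= b w n]).
Proof.
move=> hW ub.
have hit i Z := unbounded_on_infinite_set (h i) (Y := Z)
  (unbounded_increasing ub) (unbounded_nobound ub).
have /choice[f fP] : forall i, exists w, infinite_set (Y i) ->
    infinite_set (Y i `&` [set n | h i n <= b w n]).
  move=> i; have [/(hit i)[w]|Yfin] := pselect (infinite_set (Y i)).
    by exists w.
  by have [w _] := hit i _ infinite_nat; exists w.
have [w fw] := omega1_countable_bounded f hW; exists w => i /fP.
have [/(unbounded_modfin ub)|->//] := fw i.
exact: dominates_infinite_setI.
Qed.

End UnboundedSequences.

Lemma splitnode_sub (S T : set (seq nat)) t :
  S `<=` T -> splitnode S t -> splitnode T t.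
Proof.
move=> ST [St [m [n [mn Sm Sn]]]]; split; first exact: ST.
by exists m, n; split=> //; apply: ST.
Qed.

Lemma infinite_splitnode (T : set (seq nat)) t :
  T t -> infinite_set (successors T t) -> splitnode T t.
Proof.
move=> Tt /infinite_natP Tinf; split=> //.
have [m _ Tm] := Tinf 0; have [n mn Tn] := Tinf m.+1.
by exists m, n; split=> // mE; rewrite mE ltnn in mn.
Qed.

Definition prefix_cone (t : seq nat) : set (seq nat) :=
  [set u | prefix u t || prefix t u].

Lemma prefix_splitnode_cone (T : set (seq nat)) t s :
  T `<=` prefix_cone t -> splitnode T s -> prefix t s.
Proof.
move=> Tt [_ [m [n [mn Tm Tn]]]]; apply: contra_notT mn => nts.
have below k : T (rcons s k) -> prefix (rcons s k) t.
  move=> /Tt /orP[//|]; rewrite prefixs_rcons (negbTE nts) orbF => /eqP->.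
  exact: prefix_refl.
exact: prefix_rcons_inj (below m Tm) (below n Tn).
Qed.

Lemma miller_nil (T : set (seq nat)) : is_miller_tree T -> T [::].
Proof.
by move=> mT; have [t] := miller_nonempty mT; apply/(miller_tree mT)/prefix0s.
Qed.

Definition entries (A : set (seq nat)) : set nat :=
  [set m | exists2 t, A t & m \in t].

Section Stems.
Variable T : set (seq nat).
Implicit Types t u : seq nat.

(* The stem, in the usual sense, of the subtree of nodes comparable with [t]. *)
Definition stem t : set (seq nat) :=
  [set u | forall s, splitnode T s -> prefix t s -> prefix u s].

Definition stem_bound t : nat :=
  get [set M | forall m, entries (stem t) m -> m <= M].

Hypothesis mT : is_miller_tree T.

Lemma stem_rcons t u n :
  stem t u -> ~ splitnode T u -> T (rcons u n) -> stem t (rcons u n).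
Proof.
move=> tu nspu Tun s sps /(tu s sps) us.
have [|k uks] := prefix_neq_rcons us; first by apply: contra_not_neq nspu => ->.
suff -> : n = k by [].
apply: contrapT => nk; apply: nspu.
split; first exact: (miller_tree mT (prefix_rcons u n)).
by exists n, k; split=> //; apply: (miller_tree mT uks); case: sps.
Qed.

Lemma miller_stem_above_splitnode u : T u ->
  stem [::] u \/
  exists r k, [/\ splitnode T r, prefix (rcons r k) u & stem (rcons r k) u].
Proof.
elim/last_ind: u => [|u n IH] Tun; first by left=> s _ _; apply: prefix0s.
have [spu|nspu] := pselect (splitnode T u).
  by right; exists u, n; split=> //; apply: prefix_refl.
have Tu := miller_tree mT (prefix_rcons u n) Tun.
have [u0|[r [k [spr rku stem_u]]]] := IH Tu.
  by left; apply: stem_rcons.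
right; exists r, k; split=> //; last exact: stem_rcons.
exact: prefix_trans rku (prefix_rcons u n).
Qed.

Lemma entries_stem_leq t m : T t -> entries (stem t) m -> m <= stem_bound t.
Proof.
move=> Tt; have [s ts sps] := miller_split mT Tt.
have bounded : exists M, forall m, entries (stem t) m -> m <= M.
  exists (\max_(m <- s) m) => n [u /(_ s sps ts) /prefixW us nu].
  by apply: leq_bigmax_seq; rewrite ?(mem_infix us).
exact: (getPex bounded).
Qed.

Lemma miller_entry_leq_stem_bound u m : T u -> m \in u ->
  m <= stem_bound [::] \/ exists r k, [/\ splitnode T r,
    prefix (rcons r k) u & m <= stem_bound (rcons r k)].
Proof.
move=> Tu mu.
have [u0|[r [k [spr rku stem_u]]]] := miller_stem_above_splitnode Tu.
  by left; apply: (entries_stem_leq (miller_nil mT)); exists u.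
right; exists r, k; split=> //.
by apply: (entries_stem_leq (miller_tree mT rku Tu)); exists u.
Qed.

End Stems.

Lemma miller_shortest_splitnode (T : set (seq nat)) t :
  is_miller_tree T -> T t -> exists s, [/\ prefix t s, splitnode T s &
    forall r, prefix t r -> splitnode T r -> size s <= size r].
Proof.
move=> mT Tt.
pose has_splitnode n :=
  `[< exists s, [/\ prefix t s, splitnode T s & size s = n] >].
have exn : exists n, has_splitnode n.
  have [s ts sps] := miller_split mT Tt.
  by exists (size s); apply/asboolP; exists s.
case: (ex_minnP exn) => n /asboolP[s [ts sps <-]] smin.
exists s; split=> // r tr spr.
by apply: smin; apply/asboolP; exists r.
Qed.

Section Prune.
Variables (T : set (seq nat)) (G : seq nat -> set nat).
Implicit Types s t : seq nat.

Definition prune_splitnodes : set (seq nat) :=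
  [set t | T t /\ forall r n, splitnode T r -> prefix (rcons r n) t -> G r n].

Hypothesis mT : is_miller_tree T.

Lemma prune_splitnodes_sub : prune_splitnodes `<=` T.
Proof. by move=> t []. Qed.

Lemma prune_splitnodes_prefix s t :
  prefix s t -> prune_splitnodes t -> prune_splitnodes s.
Proof.
move=> st [Tt Gt]; split=> [|r n spr rns]; first exact: (miller_tree mT st).
exact: Gt spr (prefix_trans rns st).
Qed.

Lemma successors_prune_splitnodes t :
  prune_splitnodes t -> splitnode T t ->
  successors prune_splitnodes t = successors T t `&` G t.
Proof.
move=> [Tt Gt] spt; apply/seteqP; split=> n.
  by move=> [Ttn Gtn]; split=> //; apply: Gtn spt _; apply: prefix_refl.
move=> [Ttn Gn]; split=> // r k spr; rewrite prefixs_rcons.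
by move=> /predU1P[/rcons_inj[-> ->]//|]; apply: Gt.
Qed.

Hypothesis G_infinite :
  forall t, splitnode T t -> infinite_set (successors T t `&` G t).

Lemma splitnode_prune_splitnodes t :
  prune_splitnodes t -> splitnode T t -> splitnode prune_splitnodes t.
Proof.
move=> St spt; apply: infinite_splitnode => //.
by rewrite successors_prune_splitnodes //; apply: G_infinite.
Qed.

(* No splitnode of [T] lies strictly between [t] and the shortest splitnode
   above it, so pruning cannot cut the path joining them. *)
Lemma prune_splitnodes_split t :
  prune_splitnodes t -> exists2 s, prefix t s & splitnode prune_splitnodes s.
Proof.
move=> [Tt Gt]; have [s [ts sps s_min]] := miller_shortest_splitnode mT Tt.
exists s => //; apply: splitnode_prune_splitnodes => //.
split=> [|r n spr rns]; first by case: sps.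
have /orP[|] := prefix_total rns ts; first exact: Gt.
rewrite prefixs_rcons => /predU1P[tE|tr].
  by apply: Gt spr _; rewrite tE prefix_refl.
by move/size_prefix: rns; rewrite size_rcons ltnNge s_min.
Qed.

Lemma prune_splitnodes_miller : is_miller_tree prune_splitnodes.
Proof.
split.
- exists [::]; split=> [|r n _]; first exact: miller_nil.
  by rewrite prefixs0 -size_eq0 size_rcons.
- exact: prune_splitnodes_prefix.
- by move=> t /prune_splitnodes_sub; apply: miller_increasing.
- exact: prune_splitnodes_split.
- move=> t spt; have spTt := splitnode_sub prune_splitnodes_sub spt.
  rewrite successors_prune_splitnodes //; first exact: G_infinite.
  by case: spt.
Qed.

End Prune.

Section Restrict.
Variables (T : set (seq nat)) (t : seq nat).
Implicit Types s u : seq nat.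

Definition restrict_tree : set (seq nat) := T `&` prefix_cone t.

Lemma successors_restrict_tree u :
  prefix t u -> successors restrict_tree u = successors T u.
Proof.
move=> tu; apply/seteqP; split=> n; first by case.
move=> Tun; split=> //; apply/orP; right.
exact: prefix_trans tu (prefix_rcons u n).
Qed.

Lemma splitnode_restrict_treeP u :
  splitnode restrict_tree u <-> prefix t u /\ splitnode T u.
Proof.
split=> [spu|[tu [Tu spu]]].
  by split; [apply: prefix_splitnode_cone spu|apply: splitnode_sub spu] => v [].
by split; [split=> //; apply/orP; right|rewrite successors_restrict_tree].
Qed.

Lemma restrict_tree_miller :
  is_miller_tree T -> T t -> is_miller_tree restrict_tree.
Proof.
move=> mT Tt; split.
- by exists t; split=> //; apply/orP; left; apply: prefix_refl.
- move=> s u su [Tu tu]; split; first exact: (miller_tree mT su).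
  case/orP: tu => [ut|tu]; last exact: prefix_total tu.
  by apply/orP; left; apply: prefix_trans su ut.
- by move=> u [Tu _]; apply: (miller_increasing mT).
- move=> u [Tu /orP[ut|tu]].
    have [s ts sps] := miller_split mT Tt.
    by exists s; [apply: prefix_trans ut ts|apply/splitnode_restrict_treeP].
  have [s us sps] := miller_split mT Tu; exists s => //.
  by apply/splitnode_restrict_treeP; split=> //; apply: prefix_trans tu us.
- move=> u /splitnode_restrict_treeP[tu spu].
  by rewrite successors_restrict_tree //; apply: (miller_infinite mT).
Qed.

End Restrict.

Lemma miller_dominated_entries (W : Type) (lt : W -> W -> Prop)
    (b : W -> nat -> nat) (g : nat -> nat) (T : set (seq nat)) :
  is_omega1 lt -> unbounded_sequence lt b -> {homo g : m n / m <= n} ->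
  is_miller_tree T -> exists S w n, [/\ is_miller_tree S, S `<=` T &
    forall m, entries S m -> n <= m -> g m <= b w m].
Proof.
move=> hW ub g_incr mT.
pose h r n := g (stem_bound T (rcons r n)).
have [w hw] := unbounded_on_countably_many (successors T) h hW ub.
pose S := prune_splitnodes T (fun r => [set n | h r n <= b w n]).
exists S, w, (stem_bound T [::]).+1; split.
- apply: (prune_splitnodes_miller mT) => r spr.
  exact/hw/(miller_infinite mT).
- exact: prune_splitnodes_sub.
move=> m [t St /mem_rcons_prefixP[u um_t]] bound_m.
have [Tum Gum] := prune_splitnodes_prefix mT um_t St.
have m_um : m \in rcons u m by rewrite mem_rcons mem_head.
have [|[r [k [spr rk_um m_bound]]]] := miller_entry_leq_stem_bound mT Tum m_um.
  by rewrite leqNgt bound_m.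
have k_m : k <= m.
  apply: sorted_ltn_leq_last (miller_increasing mT Tum) _.
  by apply/mem_rcons_prefixP; exists r.
apply: leq_trans (g_incr _ _ m_bound) _; apply: leq_trans (Gum r k spr rk_um) _.
exact: unbounded_increasing ub _ _ _ k_m.
Qed.

(* [sval p `<=` prefix_cone t] says that [t] is an initial segment of every
   branch through [p], so this names the range of the generic branch. *)
Definition miller_range : real_name miller_forcing :=
  fun m => [set p : miller_condition |
    exists2 t, m \in t & sval p `<=` prefix_cone t].

Lemma forces_mem_miller_range (p : miller_condition) m :
  @forces miller_forcing p (Member m miller_range) -> entries (sval p) m.
Proof.
move=> /(_ p (@miller_stronger_refl p))[q qp [r [t mt rt] qr]].
have [s _ sps] := miller_split (svalP q) (miller_nil (svalP q)).
have ts : prefix t s.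
  by apply: prefix_splitnode_cone sps => u /qr; apply: rt.
exists s; first by apply: qp; case: sps.
exact: mem_infix (prefixW ts) _ mt.
Qed.

Lemma forces_infinite_miller_range (p : miller_forcing) :
  forces p (infinite_formula miller_range).
Proof.
move=> k q _ /=; have mq := svalP q.
have [s _ sps] := miller_split mq (miller_nil mq).
have /infinite_natP/(_ k)[m km qm] := miller_infinite mq sps.
pose r : miller_forcing := exist _ _ (restrict_tree_miller mq qm).
exists r; first by move=> t [].
exists m; split=> // r' r'r; exists r'; first exact: stronger_refl.
exists r => //; exists (rcons s m); last by move=> t [].
by rewrite mem_rcons mem_head.
Qed.

Lemma forces_dominates_on_miller_range (W : Type) (lt : W -> W -> Prop)
    (b : W -> nat -> nat) (g : nat -> nat) (p : miller_forcing) :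
  is_omega1 lt -> unbounded_sequence lt b -> {homo g : m n / m <= n} ->
  forces p (Ex (fun w : W => dominates_on_formula miller_range (b w) g)).
Proof.
move=> hW ub g_incr q _.
have [S [w [n [mS Sq dom]]]] := miller_dominated_entries hW ub g_incr (svalP q).
pose s : miller_forcing := exist _ S mS.
exists s => //; exists w => r rs; exists r; first exact: stronger_refl.
exists n => m r' r'r [nm /forces_mem_miller_range[t r't mt]].
by apply: dom nm; exists t => //; apply/rs/r'r.
Qed.

Theorem theorem5p6 (W : Type) (lt : W -> W -> Prop) (hW : is_omega1 lt) :
  @notion_forces miller_forcing
    (All (fun b : W -> nat -> nat => All (fun c : W -> nat -> nat =>
      Imp (And (Ground (unbounded_sequence lt b))
               (Ground (unbounded_sequence lt c)))
          (locked_formula miller_forcing b c)))).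
Proof.
move=> p b c q _ [ub uc] r _; exists r; first exact: stronger_refl.
exists miller_range; split; first exact: forces_infinite_miller_range.
split=> a.
  exact (forces_dominates_on_miller_range hW ub (unbounded_increasing uc a)).
exact (forces_dominates_on_miller_range hW uc (unbounded_increasing ub a)).
Qed.
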